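(* Let $T$ be a rooted chain complete tree, endowed with the coarse wedge topology, such that $\operatorname{ht}(T)<\omega_1\cdot\omega_0$. Then $C(T)$ is a Plichko space.
   Context: A tree is a partially ordered set $(T,<)$ such that for every $t\in T$ the set $\{s\in T:s<t\}$ is well-ordered by $<$. It is rooted if it has exactly one minimal element, and chain complete if every chain has a supremum. $\operatorname{ht}(t,T)$ is the order type of $\{s\in T:s<t\}$ and $\operatorname{ht}(T)$ is the least ordinal $\alpha$ such that no $t\in T$ has $\operatorname{ht}(t,T)=\alpha$; $t$ is on a successor level if $\operatorname{ht}(t,T)$ is a successor ordinal; $V_t=\{s\in T:s\geq t\}$. The coarse wedge topology on $T$ is the topology whose subbase consists of all sets $V_t$ and their complements, where $t$ is either minimal or on a successor level. A rooted chain complete tree is compact Hausdorff in this topology. $C(T)$ is the Banach space of real-valued or complex-valued continuous functions on $T$ with the supremum norm. $\omega_0$ denotes the first infinite ordinal and $\omega_1\cdot\omega_0=\sup_{n<\omega_0}\omega_1\cdot n$ (ordinal product). Let $X$ be a Banach space. A set $D\subset X^*$ is $\lambda$-norming if $\|x\|\leq\lambda\sup\{|x^*(x)|:x^*\in D\cap B_{X^*}\}$ for every $x\in X$, where $B_{X^*}$ is the closed unit ball of $X^*$; $D$ is norming if it is $\lambda$-norming for some $\lambda\geq1$. A subspace $S\subset X^*$ is a $\Sigma$-subspace of $X^*$ if there is $M\subset X$ with $\overline{\operatorname{span}}(M)=X$ and $S=\{f\in X^*:\{m\in M:f(m)\neq0\}\text{ is countable}\}$. $X$ is Plichko if $X^*$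 admits a norming $\Sigma$-subspace. *)

(* Defs.v *)
From HB Require Import structures.
From mathcomp Require Import all_boot all_order all_algebra.
From mathcomp Require Import all_classical all_reals all_analysis.
From mathcomp Require Import complex ring.
From mathcomp Require wochoice.

Set Implicit Arguments.
Unset Strict Implicit.
Unset Printing Implicit Defensive.
Import Order.TTheory GRing.Theory Num.Theory.
Import numFieldNormedType.Exports.

Local Open Scope classical_set_scope.
Local Open Scope ring_scope.

(** Ordinals are represented by well-ordered types, up to order isomorphism. *)

Record wellOrder := WellOrder {
  wo_sort :> eqType;
  wo_le : rel wo_sort;
  wo_leP : wochoice.well_order wo_le
}.
Arguments wo_le {w}.

Section wellOrder_theory.
Variable a : wellOrder.

Lemma wo_ex_min (A : set a) : A !=set0 ->
  exists2 z, A z & forall x, A x -> wo_le z x.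
Proof.
move=> [x Ax]; have [|z [[Az zA] _]] := @wo_leP a [pred y | `[< A y >]].
  by exists x; exact/asboolP.
by exists z; [exact/asboolP|move=> y Ay; apply: zA; exact/asboolP].
Qed.

Lemma wo_total : total (@wo_le a).
Proof.
move=> x y; have [|z [->|->] zA] := @wo_ex_min [set x; y].
- by exists x; left.
- by rewrite zA//; right.
- by rewrite (zA x) ?orbT//; left.
Qed.

Lemma wo_refl : reflexive (@wo_le a).
Proof. by move=> x; have := wo_total x x; rewrite orbb. Qed.

Lemma wo_anti : antisymmetric (@wo_le a).
Proof.
move=> x y /andP[xy yx].
have [|z [_ zU]] := @wo_leP a [pred u | (u == x) || (u == y)].
  by exists x; rewrite inE eqxx.
rewrite -(zU x) ?(zU y)//; split; rewrite ?inE ?eqxx ?orbT// => u;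
  by rewrite inE => /orP[]/eqP->//; exact: wo_refl.
Qed.

Lemma wo_trans : transitive (@wo_le a).
Proof.
move=> y x z xy yz.
have [|u [[->|->]|->] uA] := @wo_ex_min [set x; y; z].
- by exists x; left; left.
- by apply: uA; right.
- have yx : wo_le y x by apply: uA; left; left.
  by have <- : y = x by apply: wo_anti; rewrite yx.
- have zy : wo_le z y by apply: uA; left; right.
  by have -> : z = y by apply: wo_anti; rewrite zy.
Qed.

End wellOrder_theory.

Lemma well_orderI (T : eqType) (r : rel T) : antisymmetric r ->
  (forall A : set T, A !=set0 -> exists2 z, A z & forall x, A x -> r z x) ->
  wochoice.well_order r.
Proof.
move=> anti ex; apply: wochoice.antisymmetric_well_order => // A [x Ax].
by have [|z Az zA] := ex [set` A]; [exists x|exists z].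
Qed.

(** [A], ordered by [r], has order type [a]. *)
Definition order_type (T : Type) (r : rel T) (A : set T) (a : wellOrder) :=
  exists f : a -> T, {mono f : x y / wo_le x y >-> r x y} /\ range f = A.

Definition ord_eq (a b : wellOrder) := order_type (@wo_le b) [set: b] a.

(** [a] is isomorphic to the proper initial segment of [b] cut at some [y]. *)
Definition ord_lt (a b : wellOrder) :=
  exists y : b, order_type (@wo_le b) [set x | wo_le x y /\ x <> y] a.

Definition ord_le (a b : wellOrder) := ord_lt a b \/ ord_eq a b.

(** The successor [b + 1]: [None] is added on top of [b]. *)
Section ord_succ.
Variable b : wellOrder.

Definition succ_le : rel (option b) := fun x y =>
  match x, y with
  | _, None => true
  | Some x', Some y' => wo_le x' y'
  | None, Some _ => false
  end.

Lemma succ_leP : wochoice.well_order succ_le.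
Proof.
apply: well_orderI => [[x|] [y|]//= /wo_anti-> //|A [x Ax]].
have [[y Ay]|nA] := pselect (exists y, A (Some y)).
  have [|z Az zA] := @wo_ex_min b [set y | A (Some y)]; first by exists y.
  by exists (Some z) => // -[u|//]; exact: zA.
exists x => // -[u Au|_]; first by case: nA; exists u.
by case: x {Ax}.
Qed.

Definition ord_succ := WellOrder succ_leP.

End ord_succ.

(** The ordinal product [a b], i.e., [b] consecutive copies of [a]: the
    coordinate in [b] is the most significant one. *)
Section ord_mul.
Variables a b : wellOrder.

Definition mul_le : rel (b * a)%type := fun x y =>
  if x.1 == y.1 then wo_le x.2 y.2 else wo_le x.1 y.1.

Lemma mul_leP : wochoice.well_order mul_le.
Proof.
apply: well_orderI => [[x1 x2] [y1 y2]|A [[x1 x2] Ax]]; rewrite /mul_le/=.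
  rewrite (eq_sym y1); have [->|/eqP xy] := eqVneq x1 y1.
    by move=> /wo_anti->.
  by move=> /wo_anti.
have [|z1 [z2 /= Az] z1A] := @wo_ex_min b [set u | exists v, A (u, v)].
  by exists x1, x2.
have [|z3 /= Az3 z3A] := @wo_ex_min a [set v | A (z1, v)]; first by exists z2.
exists (z1, z3) => // -[u v] /= Auv; case: eqP => [zu|_].
  by apply: z3A => /=; rewrite zu.
by apply: z1A; exists v.
Qed.

Definition ord_mul := WellOrder mul_leP.

End ord_mul.

Lemma leq_well_order : wochoice.well_order leq.
Proof.
apply: well_orderI => [x y|A [x Ax]]; first exact: anti_leq.
have ex : exists n, `[< A n >] by exists x; exact/asboolP.
exists (ex_minn ex); first by case: ex_minnP => m /asboolP.
by move=> y Ay; case: ex_minnP => m _; apply; exact/asboolP.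
Qed.

Definition omega0 := WellOrder leq_well_order.

(** [a] is the least uncountable ordinal. *)
Definition is_omega1 (a : wellOrder) :=
  ~ countable [set: a] /\
  forall y : a, countable [set x : a | wo_le x y /\ x <> y].

Lemma sub_well_order (a : wellOrder) (P : pred a) :
  wochoice.well_order (fun x y : {x : a | P x} => wo_le (val x) (val y)).
Proof.
apply: well_orderI => [x y /wo_anti/val_inj//|A [x Ax]].
have [|_ [z Az <-] zA] := @wo_ex_min a (val @` A); first by exists (val x), x.
by exists z => // y Ay; apply: zA; exists y.
Qed.

Lemma inj_countable (T U : Type) (f : T -> U) (A : set T) (B : set U) :
  injective f -> (forall x, A x -> B (f x)) -> countable B -> countable A.
Proof.
move=> fI fAB /countable_injP[g gI]; apply/countable_injP; exists (g \o f).
move=> x y /set_mem Ax /set_mem Ay /= /gI/fI; apply; exact/mem_set/fAB.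
Qed.

Lemma uncountable_nat_bool : ~ countable [set: nat -> bool].
Proof.
move=> /countable_injP[f /in2TT finj].
pose D : nat -> bool := fun n =>
  `[< exists2 g : nat -> bool, f g = n & ~~ g n >].
have [Df|nDf] := boolP (D (f D)).
  by have /asboolP[g /finj-> /negP] := Df.
by move/asboolP: (nDf); apply; exists D.
Qed.

Lemma ex_omega1 : exists a, is_omega1 a.
Proof.
have [r rwo] := wochoice.well_ordering_principle ((nat -> bool) : eqType).
pose a := @WellOrder ((nat -> bool) : eqType) r rwo.
pose P : pred a := fun y => `[< countable [set x : a | wo_le x y /\ x <> y] >].
exists (WellOrder (@sub_well_order a P)); split => [cP|y]; last first.
  have /asboolP := valP y; apply: inj_countable val_inj _ => x /= [xy xNy].
  by split=> // /val_inj.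
have cP' : countable [set x | P x].
  move: cP => /countable_injP[g /in2TT gI]; apply/countable_injP.
  exists (fun x => if insub x is Some u then g u else 0%N) => x y.
  rewrite !inE => Px Py; rewrite !insubT => /gI/(congr1 val).
  by [].
have [[y nPy]|allP] := pselect (exists y, ~~ P y); last first.
  apply: uncountable_nat_bool; apply: (@inj_countable _ _ id) cP' => // x _.
  by apply: contrapT => nPx; apply: allP; exists x; exact/negP.
have [|z /= nPz zmin] := @wo_ex_min a [set y | ~~ P y]; first by exists y.
move/negP: nPz; apply; apply/asboolP.
apply: (@inj_countable _ _ id) cP' => // x /= [xz xNz].
apply: contrapT => /negP/zmin zx.
by apply: xNz; apply: (@wo_anti a); apply/andP.
Qed.

Definition omega1 : wellOrder := projT1 (cid ex_omega1).

Lemma omega1P : is_omega1 omega1.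
Proof. exact: projT2 (cid ex_omega1). Qed.

Section tree.
Context {d : Order.disp_t} (T : porderType d).
Implicit Types (t : T) (a : wellOrder).

Definition is_tree :=
  forall t, wochoice.wo_chain (<=%O : rel T) [pred s | (s < t)%O].

Definition rooted := exists! r : T, wochoice.minimal <=%O r.

Definition chain_complete :=
  forall C : set T, total_on C <=%O -> supremums C !=set0.

(** [ht(t, T) = a], as order types are only defined up to isomorphism *)
Definition node_height t a := order_type <=%O [set s | (s < t)%O] a.

(** [ht(T) = a] *)
Definition tree_height a :=
  (forall t, ~ node_height t a) /\
  forall b, (forall t, ~ node_height t b) -> ord_le a b.

Definition successor_level t := exists b, node_height t (ord_succ b).

Definition wedge t : set T := [set s | (t <= s)%O].

Definition wedge_subbase : set (set T) :=
  [set A | exists2 t, wochoice.minimal <=%O t \/ successor_level t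
                    & A = wedge t \/ A = ~` wedge t].

End tree.
Arguments wedge_subbase {d} T.

Definition coarse_wedge {d : Order.disp_t} (T : porderType d) : Type := T.

HB.instance Definition _ d (T : porderType d) :=
  Order.POrder.copy (coarse_wedge T) T.
HB.instance Definition _ d (T : porderType d) :=
  isSubBaseTopological.Build (coarse_wedge T) (wedge_subbase T) id.

Section coarse_wedge_compact.
Context {d : Order.disp_t} {T : porderType d}.
Hypotheses (treeT : is_tree T) (rootT : rooted T) (ccT : chain_complete T).

Lemma tree_down_total t (x y : T) : (x <= t)%O -> (y <= t)%O ->
  (x <= y)%O || (y <= x)%O.
Proof.
move=> xt yt; have [->|xNt] := eqVneq x t; first by rewrite yt orbT.
have [->|yNt] := eqVneq y t; first by rewrite xt.
by apply: (wochoice.wo_chainW (@treeT t)); rewrite inE lt_neqAle ?xNt ?yNt.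
Qed.

Lemma tree_root : exists2 r : T, wochoice.minimal <=%O r & forall t, (r <= t)%O.
Proof.
have [r [minr rU]] := rootT; exists r => // t.
have [st|nst] := pselect (exists s, (s < t)%O); last first.
  by rewrite (rU t)// => s st; have [->|nst'] := eqVneq s t;
     [exact: lexx|case: nst; exists s; rewrite lt_neqAle nst'].
have [//|s [[/= sT smin] _]] := @treeT t [pred s | (s < t)%O] (fun x => id).
rewrite (rU s) ?ltW// => u us; apply: smin.
by rewrite inE (le_lt_trans us).
Qed.

Lemma successor_level_pred (t : T) : successor_level t ->
  exists2 p : T, (p < t)%O & forall s, (s < t)%O -> (s <= p)%O.
Proof.
move=> [b [f [fmono fr]]]; exists (f None).
  by have : range f (f None) by []; rewrite fr.
move=> s st; have : [set s | (s < t)%O] s by [].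
by rewrite -fr => -[x _ <-]; rewrite fmono; case: x.
Qed.

Lemma coarse_wedge_compact : compact [set: coarse_wedge T].
Proof.
rewrite compact_ultra => F UF _.
pose G (t : T) := wochoice.minimal <=%O t \/ successor_level t.
pose C : set T := [set t | G t /\ F (wedge t)].
have Ctot : total_on C <=%O.
  move=> x y [_ Fx] [_ Fy]; have [z [xz yz]] := filter_ex (filterI Fx Fy).
  by apply/orP; exact: tree_down_total xz yz.
have [t [Ct tC]] := ccT Ctot; exists t; split => //.
have [r rmin rle] := tree_root.
have Cr : C r.
  by split; [left|apply: filterS filterT => s _; exact: rle].
have inC s : G s -> (s <= t)%O -> F (wedge s).
  move=> Gs st; apply: contrapT => nFs.
  have Clt c : C c -> (c < s)%O.
    move=> Cc; have /orP[cs|sc] := tree_down_total (Ct _ Cc) st.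
      by rewrite lt_neqAle cs andbT; apply/eqP => cE; case: nFs; rewrite -cE; case: Cc.
    by case: nFs; case: Cc => _; apply: filterS => u; exact: le_trans.
  have ts : (t <= s)%O by apply: tC => c /Clt/ltW.
  case: Gs => [mins|/successor_level_pred[p ps sp]].
    have := Clt r Cr; rewrite lt_neqAle => /andP[+ /mins sr].
    by rewrite eq_le sr rle.
  have tp : (t <= p)%O by apply: tC => c /Clt/sp.
  by have := lt_le_trans ps (le_trans st tp); rewrite ltxx.
have subF A : wedge_subbase T A -> A t -> F A.
  move=> [s Gs [->|->]] /= At; first exact: inC.
  have [Fs|//] := in_ultra_setVsetC (wedge s) UF.
  by case: At; apply: Ct; split.
move=> A; rewrite nbhsE => -[B [[D Dsub <-] [E DE Et]] BA].
apply: filterS BA _; apply: (@filterS _ F _ E); first by move=> x Ex; exists E.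
have [I IE Ieq] := Dsub _ DE; rewrite -Ieq.
apply: filter_bigI => U IU; apply: subF; first exact/set_mem/IE.
by move: Et; rewrite -Ieq; apply.
Qed.

End coarse_wedge_compact.

Variant scalar_field (R : realType) : numFieldType -> Prop :=
  | RealScalars : scalar_field R R
  | ComplexScalars : scalar_field R (Num.NumField.clone R[i] _).

Section scalar_field_theory.
Context {R : realType}.

Lemma scalar_supremums (K : numFieldType) (A : set K) :
  scalar_field R K -> A !=set0 -> (forall x, A x -> 0 <= x) ->
  ubound A !=set0 -> supremums A !=set0.
Proof.
move=> sK; case: sK A => A A0 Apos [M AM].
  have hA : has_sup A by split => //; exists M.
  exists (sup A); split; first exact: sup_upper_bound.
  by move=> x Ax; apply: ge_sup => //; case: hA.
have AE x : A x -> x = (complex.Re x)%:C%C.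
  by move=> /Apos; case: x => a b; rewrite lecE/= => /andP[/eqP->].
pose B := (fun z : R[i] => complex.Re z) @` A.
have hB : has_sup B.
  split; first by case: A0 => x Ax; exists (complex.Re x), x.
  exists (complex.Re M) => _ [x Ax <-].
  by have := AM _ Ax; rewrite lecE => /andP[].
exists (sup B)%:C%C; split => [x Ax|y yA].
  rewrite (AE _ Ax) lecR; apply: sup_upper_bound => //.
  by exists x.
have [x Ax] := A0; have := yA _ Ax; rewrite (AE _ Ax) !lecE/= => /andP[-> _]/=.
apply: ge_sup; first by case: hB.
by move=> _ [z Az <-]; have := yA _ Az; rewrite lecE => /andP[].
Qed.

Lemma scalar_complete (K : numFieldType) (F : set_system K) :
  scalar_field R K -> ProperFilter F -> cauchy F -> cvg F.
Proof.
move=> sK; case: sK F => F FF Fc; first exact: R_complete.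
have Fb e : 0 < e -> \forall x & y \near F, `|x - y| < e%:C%C.
  by move=> e0; apply: (@cauchy_ballP _ _ F _).2 => //; rewrite ltcR.
have part (p : R[i] -> R) : (forall z w, `|p z - p w|%:C%C <= `|z - w|) ->
    exists l : R, p @ F --> l.
  move=> pN; suff : cvg (p @ F) by move=> /cvg_ex.
  apply: R_complete.
  apply/cauchy_ballP => e e0; rewrite near_map2.
  apply: filterS (Fb e e0) => -[z w] /=.
  by rewrite /ball/= -ltcR; apply: le_lt_trans.
have [|a Fa] := part (@complex.Re R).
  by move=> z w; rewrite -raddfB normc_ge_Re.
have [|b Fbb] := part (@complex.Im R).
  move=> z w; rewrite -raddfB; case: (z - w) => u v /=.
  by rewrite normc_def/= lecR -sqrtr_sqr ler_sqrt ?addr_ge0 ?sqr_ge0// lerDr sqr_ge0.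
pose C := Num.NumField.clone R[i] _; pose l : C := (a +i* b)%C.
apply: (@cvgP C _ l); apply/cvgrPdist_lt => -[e e'].
rewrite ltcE/= => /andP[/eqP e'E e0]; rewrite {e'}e'E.
have e20 : 0 < e / 2 by rewrite divr_gt0.
have Fa' := proj1 (cvgrPdist_lt _ _) Fa _ e20.
have Fb' := proj1 (cvgrPdist_lt _ _) Fbb _ e20.
have lE (z : C) : l - z = ((a - complex.Re z) +i* (b - complex.Im z))%C.
  by case: z.
near=> z; have za : `|a - complex.Re z| < e / 2 by near: z; exact: Fa'.
have zb : `|b - complex.Im z| < e / 2 by near: z; exact: Fb'.
rewrite lE normc_def ltcR/=; set u := complex.Re z; set v := complex.Im z.
rewrite (le_lt_trans _ (_ : `|a - u| + `|b - v| < e))//; last first.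
  by rewrite (splitr e) ltrD.
rewrite -[leRHS]ger0_norm ?addr_ge0// -sqrtr_sqr ler_sqrt ?sqr_ge0//.
rewrite [leRHS]sqrrD !real_normK ?num_real// lerD2r lerDl.
by rewrite mulrn_wge0// mulr_ge0.
Unshelve. all: by end_near. Qed.

End scalar_field_theory.

Section continuous_pred.
Variables (X : topologicalType) (K : numFieldType).

Definition continuous_pred : {pred X -> K^o} :=
  mem [set f : X -> K | continuous f].

Lemma continuous_pred_submod : submod_closed continuous_pred.
Proof.
split; first by rewrite inE; exact: cst_continuous.
move=> k f g; rewrite !inE => cf cg x; apply: cvgD; last exact: cg.
apply: cvgM; [exact: cvg_cst|exact: cf].
Qed.

HB.instance Definition _ := GRing.isSubmodClosed.Build K (X -> K^o)
  continuous_pred continuous_pred_submod.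

End continuous_pred.

(** C(X) for a compact space X. The two proof arguments are what makes the
    supremum norm well defined and complete. *)
Definition cont_space (R : realType) (K : numFieldType) (X : topologicalType)
    (sK : scalar_field R K) (cX : compact [set: X]) : Type :=
  {f : X -> K^o | f \in @continuous_pred X K}.

Section cont_space.
Context {R : realType} {K : numFieldType} {X : topologicalType}.
Variables (sK : scalar_field R K) (cX : compact [set: X]).

Local Notation CX := (cont_space sK cX).

HB.instance Definition _ := SubChoice.copy CX
  {f : X -> K^o | f \in @continuous_pred X K}.
HB.instance Definition _ := [SubChoice_isSubZmodule of CX by <:].
HB.instance Definition _ := [SubZmodule_isSubLmodule of CX by <:].

Definition sup_norm (f : CX) : K := supremum 0 [set `|val f x| | x in [set: X]].

Lemma cont_space_continuous (f : CX) : continuous (val f : X -> K).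
Proof. by have := valP f; rewrite inE. Qed.

Lemma cont_space_bounded (f : CX) : exists M : K, forall x, `|val f x| <= M.
Proof.
suff [M [_ fM]] : \forall M \near +oo, [set: X] `<=` (fun x => `|val f x| <= M).
  by exists (M + 1) => x; apply: (fM (M + 1)); rewrite ?ltrDl.
apply: ((compact_near_coveringP [set: X]).1 cX K +oo (fun M x => `|val f x| <= M)).
move=> x _.
have fx := @cont_space_continuous f x : val f @ x --> val f x.
near=> y M => /=.
have -> : val f y = val f x - (val f x - val f y) by rewrite subKr.
rewrite (le_trans (ler_normB _ _))//.
rewrite (@le_trans _ _ (`|val f x| + 1))//.
by rewrite lerD2l; near: y; move/cvgrPdist_le : fx; apply.
Unshelve. all: by end_near. Qed.

Lemma sup_normP (f : CX) : supremums [set `|val f x| | x in [set: X]] !=set0 \/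
  [set `|val f x| | x in [set: X]] = set0.
Proof.
have [X0|X0] := pselect (exists x : X, True); [left; case: X0 => x _|right].
  apply: (scalar_supremums sK); first by exists `|val f x|, x.
    by move=> _ [y _ <-].
  by have [M fM] := cont_space_bounded f; exists M => _ [y _ <-].
by rewrite -subset0 => z [y _ _]; apply: X0; exists y.
Qed.

Lemma sup_norm_ge (f : CX) x : `|val f x| <= sup_norm f.
Proof.
have Ax : [set `|val f x| | x in [set: X]] `|val f x| by exists x.
have [[z zs]|f0] := sup_normP f; last by move: Ax; rewrite f0.
rewrite /sup_norm /supremum ifF; last by apply/eqP => f0; move: Ax; rewrite f0.
by case: xgetP => [_ -> [+ _]|/(_ z)//]; apply.
Qed.

Lemma sup_norm_le (f : CX) (M : K) : 0 <= M ->
  (forall x, `|val f x| <= M) -> sup_norm f <= M.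
Proof.
move=> M0 fM; rewrite /sup_norm /supremum; case: ifPn => // /set0P[y Ay].
have [fs|f0] := sup_normP f; last by move: Ay; rewrite f0.
case: xgetP => [z -> [_]|/(_ _)]; first by apply=> _ [x _ <-].
by case: fs => z zs /(_ z).
Qed.

Lemma sup_norm_ge0 (f : CX) : 0 <= sup_norm f.
Proof.
have [x|X0] := pselect (exists x : X, True).
  by case: x => x _; exact: le_trans (sup_norm_ge f x).
by rewrite /sup_norm supremum_out// => -[[z [x _ _]] _]; apply: X0; exists x.
Qed.

Lemma sup_normD (f g : CX) : sup_norm (f + g) <= sup_norm f + sup_norm g.
Proof.
apply: sup_norm_le => [|x]; first by rewrite addr_ge0 ?sup_norm_ge0.
by rewrite (le_trans (ler_normD _ _))// lerD// sup_norm_ge.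
Qed.

Lemma sup_normZ (k : K) (f : CX) : sup_norm (k *: f) = `|k| * sup_norm f.
Proof.
have le (l : K) (g : CX) : sup_norm (l *: g) <= `|l| * sup_norm g.
  apply: sup_norm_le => [|x]; first by rewrite mulr_ge0 ?sup_norm_ge0.
  by rewrite [X in X <= _]normrM ler_wpM2l// sup_norm_ge.
apply/eqP; rewrite eq_le le /=; have [->|k0] := eqVneq k 0.
  by rewrite normr0 mul0r sup_norm_ge0.
rewrite -ler_pdivlMl ?normr_gt0// -normfV.
by rewrite (le_trans _ (le _ _))// scalerA mulVf// scale1r.
Qed.

Lemma sup_norm_eq0 (f : CX) : sup_norm f = 0 -> f = 0.
Proof.
move=> f0; apply/val_inj/funext => x; apply/eqP.
by rewrite -normr_le0 -f0 sup_norm_ge.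
Qed.

HB.instance Definition _ := Lmodule_isNormed.Build K CX
  sup_normD sup_normZ sup_norm_eq0.

Lemma cont_space_normE (f : CX) : `|f| = sup_norm f.
Proof. by []. Qed.

Lemma cont_space_complete (F : set_system CX) :
  ProperFilter F -> cauchy F -> cvg F.
Proof.
move=> FF Fc.
have Fb e : 0 < e -> \forall f & g \near F, `|f - g| < e.
  by move=> e0; have := proj2 (@cauchy_ballP K CX F _) Fc e e0; apply.
have Fe e : 0 < e -> \forall f & g \near F, forall x, `|val f x - val g x| < e.
  move=> /Fb; apply: filterS => -[f g] /= fg x.
  by apply: le_lt_trans fg; exact: (@sup_norm_ge (f - g) x).
have Fx x : exists l, (fun f : CX => (val f x : K)) @ F --> (l : K).
  suff : cvg ((fun f : CX => (val f x : K)) @ F) by move=> /cvg_ex.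
  apply: (scalar_complete sK).
  apply/cauchy_ballP => e e0; rewrite near_map2.
  by apply: filterS (Fe e e0) => -[f g] /=; exact.
have [l Fl] := choice Fx.
have Fle e : 0 < e -> \forall f \near F, forall x, `|l x - val f x| <= e.
  move=> e0; have e20 : 0 < e / 2 by rewrite divr_gt0.
  apply: filterS (nearP_dep (Fe _ e20)) => f ff x.
  have /cvgrPdist_lt/(_ _ e20) Flx := Fl x.
  have [g [fg lg]] := filter_ex (filterI ff Flx).
  rewrite (splitr e) (le_trans (ler_distD (val g x) _ _))// lerD ?ltW//.
  by rewrite distrC.
have cl : continuous (l : X -> K).
  move=> x; apply/cvgrPdist_le => e e0.
  have e30 : 0 < e / 3 by rewrite divr_gt0.
  have [f lf] := filter_ex (Fle _ e30).
  have /cvgrPdist_le/(_ _ e30) := @cont_space_continuous f x.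
  apply: filterS => y fxy.
  rewrite (le_trans (ler_distD (val f x) _ _))//.
  rewrite (_ : e = e / 3 + (e / 3 + e / 3)); last by field.
  rewrite lerD// (le_trans (ler_distD (val f y) _ _))// lerD//.
  by rewrite distrC.
have lP : (l : X -> K^o) \in @continuous_pred X K by rewrite inE.
apply/cvg_ex; exists (exist _ l lP : CX).
apply/cvgrPdist_le => e e0; apply: filterS (Fle e e0) => f lf.
by apply: sup_norm_le => //; exact: ltW.
Qed.

HB.instance Definition _ := Uniform_isComplete.Build CX cont_space_complete.

End cont_space.

Section Plichko.
Context {K : numFieldType} (X : completeNormedModType K).

Record dual := Dual {
  dual_fun :> {scalar X};
  dual_continuous : continuous (dual_fun : X -> K)
}.

(** Norms take values in [K]. For [K] a [realType], [supremum 0] is [sup]; for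
    [K] the complex numbers, it is the same real supremum, as the order of
    [R[i]] restricts to that of [R] and all the elements concerned are real. *)
Definition dual_norm (f : dual) : K :=
  supremum 0 [set `|f x| | x in [set x | `|x| <= 1]].

Definition dual_ball : set dual := [set f | dual_norm f <= 1].

Definition lambda_norming (l : K) (D : set dual) :=
  forall x : X, `|x| <= l * supremum 0 [set `|f x| | f in D `&` dual_ball].

Definition norming (D : set dual) := exists2 l, 1 <= l & lambda_norming l D.

Definition linear_span (M : set X) : set X :=
  [set x | exists n (c : 'I_n -> K) (m : 'I_n -> X),
    (forall i, M (m i)) /\ x = \sum_(i < n) c i *: m i].

(** A set of this form is automatically a linear subspace of the dual. *)
Definition Sigma_subspace (S : set dual) :=
  exists2 M : set X, closure (linear_span M) = [set: X] &
    S = [set f | countable [set m | M m /\ f m <> 0]].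

Definition Plichko := exists2 S, Sigma_subspace S & norming S.

End Plichko.

(* Main.v *)
From HB Require Import structures.
Require Import Defs.
From mathcomp Require Import all_boot all_order all_algebra.
From mathcomp Require Import all_classical all_reals all_analysis.
From mathcomp Require Import finmap ring.
From mathcomp Require wochoice.

(** Functions on [T] are approximated by combinations of indicators of the wedges
    [V_s] with [s] minimal or on a successor level: these wedges are clopen, two
    of them are nested or disjoint, so the indicators span an algebra, and
    together with their complements they generate the topology. Hence the set [M]
    of these indicators has a dense span ([wedge_indicators_dense]), and it
    remains to see that the functionals that are nonzero on only countably many
    members of [M] are norming.

    Call two comparable nodes close if the interval between them is countable.
    Closeness cuts the set of nodes below a given [t] into intervals, the blocks;
    let [q] be the least node close to [t]. An indicator of [V_s] distinguishes
    [t] from [q] only if [q < s <= t], so [(delta_t - delta_q) / 2] is countably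
    supported on [M], and so is [delta_t] if [q] is the root
    ([difference_functional], [point_functional]). If [q] is not the root, then it
    is on a limit level, since an immediate predecessor would again be close to
    [t]; the topology does not separate such a node from the nodes below it
    ([limit_node_cvg]), and all of these lie in lower blocks. If [C] bounds the
    values at [x] of all countably supported functionals of norm at most one, it
    follows that [`|x t| <= 2 C + `|x q|], where [`|x q|] is at most the
    supremum of [`|x|] over lower blocks. By induction [`|x t| <= (2 k + 1) C]
    when at most [k] blocks lie below that of [t] ([block_norm_bound]).

    For [lambda] to be uniform the number of blocks must be bounded on [T], and
    this is what the height is for: as [ht(T) < omega1 omega0], the heights of
    the nodes lie in finitely many copies of [omega1], and nodes with height in
    the same copy are close ([tree_blocks]). *)

Set Implicit Arguments.
Unset Strict Implicit.
Unset Printing Implicit Defensive.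

Import Order.TTheory GRing.Theory Num.Theory.
Import numFieldNormedType.Exports.

Local Open Scope classical_set_scope.
Local Open Scope ring_scope.

(** * Heights and blocks of length omega1 *)

Lemma countable_setU (T : Type) (A B : set T) :
  countable A -> countable B -> countable (A `|` B).
Proof.
move=> cA cB; rewrite -bigcup2E; apply: bigcup_countable => // -[|[|n]] _ //=.
Qed.

Section wo_lt.
Variable a : wellOrder.

Definition wo_lt (x y : a) := wo_le x y /\ x <> y.

Lemma wo_leNlt (x y : a) : ~ wo_lt x y -> wo_le y x.
Proof.
move=> nxy; have /orP[xy|//] := wo_total x y.
have [->|/eqP xNy] := eqVneq x y; first exact: wo_refl.
by case: nxy; split.
Qed.

End wo_lt.

Section tree_order.
Context {d : Order.disp_t} {T : porderType d}.
Hypothesis treeT : is_tree T.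

Lemma tree_least (t : T) (A : set T) : A !=set0 -> (forall s, A s -> (s <= t)%O) ->
  exists2 q, A q & forall s, A s -> (q <= s)%O.
Proof.
move=> [a Aa] At.
have [[b [Ab bt]]|nb] := pselect (exists b, A b /\ (b < t)%O).
  have [x||q [[/andP[/asboolP Aq qt] qmin] _]] :=
    @treeT t [pred s | `[< A s >] && (s < t)%O].
  - by case/andP.
  - by exists b; rewrite inE bt andbT; exact/asboolP.
  exists q => // s As; have [->|sNt] := eqVneq s t; first exact: ltW.
  by apply: qmin; rewrite inE lt_neqAle sNt At// !andbT; exact/asboolP.
have AE x : A x -> x = t.
  move=> Ax; apply/eqP; apply: contrapT => /negP xNt; apply: nb.
  by exists x; split => //; rewrite lt_neqAle xNt At.
by exists a => // s /AE->; rewrite (AE a).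
Qed.

Lemma tree_lt_wf : well_founded (fun s t : T => (s < t)%O).
Proof.
move=> t; apply: contrapT => nt.
have [||q [nq qt] qmin] := @tree_least t
    [set s | ~ Acc (fun s t : T => (s < t)%O) s /\ (s <= t)%O].
- by exists t.
- by move=> s [].
apply: nq; constructor => s sq; apply: contrapT => ns.
have := qmin s (conj ns (le_trans (ltW sq) qt)).
by move=> /(lt_le_trans sq); rewrite ltxx.
Qed.

Section tree_rank.
Variable h : wellOrder.

Definition rank_bound (t : T) (rho : forall s : T, (s < t)%O -> option h) : set h :=
  [set z | forall s (st : (s < t)%O), exists2 y, rho s st = Some y & wo_lt y z].

Definition rank_step (t : T) (rho : forall s : T, (s < t)%O -> option h) :
    option h :=
  if pselect (rank_bound rho !=set0) is left ex
  then Some (projT1 (cid2 (wo_ex_min ex))) else None.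

(** The height of a node read inside [h], as the least strict upper bound of the
    ranks of its predecessors; [None] when [h] is exhausted. *)
Definition rank : T -> option h := Fix tree_lt_wf (fun=> option h) rank_step.

Lemma rankE (t : T) : rank t = @rank_step t (fun s _ => rank s).
Proof.
rewrite [LHS]Fix_eq// => u f g fg; congr rank_step.
by apply: functional_extensionality_dep => s; apply: functional_extensionality_dep.
Qed.

Lemma rank_Some (t : T) (z : h) : rank t = Some z ->
  (forall s, (s < t)%O -> exists2 y, rank s = Some y & wo_lt y z) /\
  (forall y, wo_lt y z -> exists2 s, (s < t)%O &
     ~ exists2 y', rank s = Some y' & wo_lt y' y).
Proof.
rewrite rankE /rank_step; case: pselect => // ex [].
case: cid2 => /= x xb xmin <-; split => [s st|y [yx yNx]]; first exact: xb.
apply: contrapT => ns; apply: yNx; apply: (@wo_anti h); rewrite yx xmin// => s st.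
by apply: contrapT => nrs; apply: ns; exists s.
Qed.

Lemma rank_None (t : T) : rank t = None ->
  forall z, exists2 s, (s < t)%O & ~ exists2 y, rank s = Some y & wo_lt y z.
Proof.
rewrite rankE /rank_step; case: pselect => // nex _ z.
apply: contrapT => ns; apply: nex; exists z => s st.
by apply: contrapT => nrs; apply: ns; exists s.
Qed.

(** Taking the least available value leaves no gap. *)
Lemma rank_initial (t : T) (z y : h) : rank t = Some z -> wo_lt y z ->
  exists2 s, (s < t)%O & rank s = Some y.
Proof.
elim/(well_founded_ind tree_lt_wf): t z y => t IH z y tz yz.
have [zb /(_ _ yz)[s st sy]] := rank_Some tz.
have [x sx _] := zb s st.
have yx : wo_le y x by apply: wo_leNlt => xy; apply: sy; exists x.
have [yEx|/eqP yNx] := eqVneq y x; first by exists s => //; rewrite yEx.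
have [u us uy] := IH s st x y sx (conj yx yNx).
by exists u => //; exact: lt_trans st.
Qed.

(** At a minimal node [t] where no value is left, the ranks of the nodes below
    [t] exhaust [h], that is, [t] has height [h]. *)
Lemma rank_total : (forall t : T, ~ node_height t h) -> forall t, rank t <> None.
Proof.
move=> nh t0 t0N; have [||t [tN _] tmin] :=
  @tree_least t0 [set t | rank t = None /\ (t <= t0)%O].
- by exists t0.
- by move=> s [].
have {t0N} tt0 : (t <= t0)%O by apply: tmin.
have tS s : (s < t)%O -> exists x, rank s = Some x.
  case E : (rank s) => [x|] st; first by exists x.
  have /(lt_le_trans st) := tmin s (conj E (le_trans (ltW st) tt0)).
  by rewrite ltxx.
have onto y : exists s, (s < t)%O /\ rank s = Some y.
  have [s st nsy] := rank_None tN y; have [x sx] := tS s st.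
  have yx : wo_le y x by apply: wo_leNlt => xy; apply: nsy; exists x.
  have [yEx|/eqP yNx] := eqVneq y x; first by exists s; rewrite yEx.
  have [u us uy] := rank_initial sx (conj yx yNx).
  by exists u; split => //; exact: lt_trans st.
have [f fP] := choice onto.
have f_lt x y : (f x < f y)%O -> wo_lt x y.
  have [_ /rank_Some[/(_ (f x)) + _]] := fP y.
  by move=> /[apply] -[z]; rewrite (fP x).2 => -[<-].
have tree_le x y : (x < t)%O -> (y < t)%O -> (x <= y)%O \/ (y < x)%O.
  move=> xt yt; have [->|xNy] := eqVneq x y; first by left.
  have /orP[->|yx] := tree_down_total treeT (ltW xt) (ltW yt); [by left|].
  by right; rewrite lt_neqAle yx eq_sym xNy.
apply: (nh t); exists f; split => [x y|].
  have [fxy|fyx] := tree_le _ _ (fP x).1 (fP y).1.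
    rewrite fxy; have [<-|xNy] := eqVneq x y; first by rewrite wo_refl.
    have /f_lt[->//] : (f x < f y)%O.
    rewrite lt_neqAle fxy andbT; apply: contra_neq xNy => fE.
    by have := (fP x).2; rewrite fE (fP y).2 => -[].
  rewrite lt_geF//; apply/esym/negbTE/negP => xy.
  by have [yx] := f_lt _ _ fyx; apply; apply: (@wo_anti h); rewrite yx xy.
rewrite eqEsubset; split => [_ [x _ <-]|s st]; first exact: (fP x).1.
have [x sx] := tS s st; exists x => //.
have aux u v : (u < v)%O -> rank u = Some x -> rank v = Some x -> False.
  move=> uv ux /rank_Some[/(_ u uv)[y]]; rewrite ux => -[<-] [_]; exact.
have [fs|sf] := tree_le _ _ (fP x).1 st; last by case: (aux _ _ sf sx (fP x).2).
apply/eqP; apply: contrapT => /negP fNs.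
by apply: (aux (f x) s) => //; [rewrite lt_neqAle fNs|exact: (fP x).2].
Qed.

End tree_rank.

(** If no node has height [h], then all heights are below [h] and can be read as
    elements of [h] by [rank]. *)
Lemma tree_rank (h : wellOrder) : (forall t : T, ~ node_height t h) ->
  exists rho : T -> h, forall s t, (s < t)%O -> wo_lt (rho s) (rho t).
Proof.
move=> nh; have ex t : exists z, rank h t = Some z.
  by case E : (rank h t) => [z|]; [exists z|case: (rank_total nh E)].
have [rho rhoP] := choice ex; exists rho => s t st.
have [/(_ s st)[y + yt] _] := rank_Some (rhoP t).
by rewrite rhoP => -[->].
Qed.

Definition countably_close (u t : T) := countable [set s : T | (u <= s)%O /\ (s <= t)%O].

Lemma countably_close_refl (t : T) : countably_close t t.
Proof.
apply: (@inj_countable _ _ id _ [set t]) => // s [ts st] /=.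
by apply/eqP; rewrite eq_le st ts.
Qed.

Lemma countably_close_trans (u s t : T) : (s <= t)%O -> countably_close u s -> countably_close s t -> countably_close u t.
Proof.
move=> st us /(countable_setU us).
apply: (@inj_countable _ _ id) => // x [ux xt].
by have /orP[xs|sx] := tree_down_total treeT xt st; [left|right].
Qed.

(** An element of [omega1 * omega0] is a pair of a copy of [omega1] and a position
    in it. For nodes with height in the same copy, the positions embed the
    interval between them into an initial segment of [omega1]. *)
Lemma tree_blocks (h : wellOrder) : (forall t : T, ~ node_height t h) ->
  ord_lt h (ord_mul omega1 omega0) ->
  exists (n : nat) (b : T -> nat), [/\ forall t, (b t <= n)%N,
    forall s t, (s <= t)%O -> (b s <= b t)%N &
    forall s t, b s = b t -> countably_close s t].
Proof.
move=> /tree_rank[rho rhoP] [y [f [fmono fr]]].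
pose g t := f (rho t).
have gmono s t : (s < t)%O -> wo_lt (g s) (g t).
  move=> /rhoP[st sNt]; split; first by rewrite fmono.
  by move=> gE; apply: sNt; apply: (@wo_anti h); rewrite -!fmono -/(g s) gE wo_refl.
have mul1 (p q : ord_mul omega1 omega0) : wo_le p q -> (p.1 <= q.1)%N.
  by rewrite /wo_le/= /mul_le; case: eqP => [->//|].
have gle s t : (s <= t)%O -> wo_le (g s) (g t).
  by rewrite le_eqVlt => /orP[/eqP->|/gmono[]//]; exact: wo_refl.
exists y.1, (fun t => (g t).1); split => [t|s t /gle/mul1//|s t stE].
  apply: mul1; have : range f (g t) by exists (rho t).
  by rewrite fr => -[].
(* within a copy the order is that of the positions *)
have inner u v : (u <= v)%O -> (g u).1 = (g v).1 -> wo_le (g u).2 (g v).2.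
  by move=> /gle; rewrite {1}/wo_le/= /mul_le => + E; rewrite E eqxx.
have cz (z : omega1) : countable [set x : omega1 | wo_le x z].
  apply: (@inj_countable _ _ id _ ([set z] `|` [set x | wo_le x z /\ x <> z])) => //.
    by move=> x xz /=; have [->|/eqP] := eqVneq x z; [left|right].
  by apply: countable_setU => //; exact: omega1P.2.
have gE u : (s <= u)%O -> (u <= t)%O -> (g u).1 = (g t).1.
  move=> /gle/mul1 su /gle/mul1 ut; apply/eqP; rewrite eqn_leq ut.
  by rewrite -stE su.
have /countable_injP[F FI] := cz (g t).2.
apply/countable_injP; exists (F \o (fun u => (g u).2)).
move=> u v /set_mem[su ut] /set_mem[sv vt] /= FE.
have gE2 : (g u).2 = (g v).2.
  by apply: FI FE; apply/mem_set; apply: inner => //; exact: gE.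
have gEuv : g u = g v by apply: injective_projections => //; rewrite !gE.
have /orP[] := tree_down_total treeT ut vt; rewrite le_eqVlt => /orP[/eqP//|/gmono[_]];
  by rewrite gEuv.
Qed.

Lemma block_bottom (t : T) : exists q : T,
  [/\ (q <= t)%O, countably_close q t & forall u, (u <= t)%O -> countably_close u t -> (q <= u)%O].
Proof.
have [||q [qt cq] qmin] := @tree_least t [set u | (u <= t)%O /\ countably_close u t].
- by exists t; split => //; exact: countably_close_refl.
- by move=> s [].
by exists q; split => // u ut cu; exact: qmin.
Qed.

(** An immediate predecessor of [q] would be at countable distance from [t] too,
    contradicting minimality. *)
Lemma block_bottom_limit (q t : T) : (q <= t)%O -> countably_close q t ->
  (forall u, (u <= t)%O -> countably_close u t -> (q <= u)%O) -> ~ successor_level q.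
Proof.
move=> qt cq qmin /successor_level_pred[p pq pmax].
have /(lt_le_trans pq) : (q <= p)%O; last by rewrite ltxx.
apply: qmin; first exact: le_trans (ltW pq) qt.
apply: countably_close_trans qt _ cq.
have : countable [set p; q] by apply: countable_setU; exact: countable1.
apply: (@inj_countable _ _ id) => // x [px].
rewrite le_eqVlt => /orP[/eqP->|/pmax xp]; [by right|left].
by apply/eqP; rewrite eq_le px xp.
Qed.

End tree_order.

(** * The coarse wedge topology *)

Section wedge_topology.
Context {d : Order.disp_t} {T : porderType d}.
Implicit Types (t q : coarse_wedge T).

Lemma wedge_subbase_open (A : set (coarse_wedge T)) : wedge_subbase T A -> open A.
Proof.
move=> sA; exists [set A]; last by rewrite bigcup_set1.
move=> _ ->; exists [fset A]%fset.
  by move=> B; rewrite inE => /eqP->; exact/mem_set.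
by rewrite set_fset1 bigcap_set1.
Qed.

Lemma wedge_filter_cvg t (F : set_system (coarse_wedge T)) : Filter F ->
  (forall A, wedge_subbase T A -> A t -> F A) -> F --> t.
Proof.
move=> FF subF A; rewrite nbhsE => -[B [[D Dsub <-] [E DE Et]] BA].
apply: filterS BA _; apply: (@filterS _ F _ E); first by move=> x Ex; exists E.
have [I IE Ieq] := Dsub _ DE; rewrite -Ieq.
apply: filter_bigI => U IU; apply: subF; first exact/set_mem/IE.
by move: Et; rewrite -Ieq; apply.
Qed.

Hypothesis treeT : is_tree T.

(** A basic neighbourhood of [q] is cut out by finitely many wedges containing [q],
    whose roots are strictly below [q] as [q] is neither minimal nor on a
    successor level, and by finitely many complements of wedges that avoid [q],
    hence avoid everything below it. So it contains a final segment of the nodes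
    below [q]. *)
Lemma limit_node_cvg q (A : set (coarse_wedge T)) :
  (exists r : T, (r < q)%O) -> ~ successor_level (q : T) -> nbhs q A ->
  exists2 s, (s < q)%O & A s.
Proof.
move=> [r rq] nsq.
pose F : set_system (coarse_wedge T) := [set B |
  exists2 a, (a < q)%O & forall s, (a <= s)%O -> (s < q)%O -> B s].
have FF : Filter F.
  split; first by exists r.
  - move=> B C [a aq aB] [b bq bC].
    have /orP[ab|ba] := tree_down_total treeT (ltW aq) (ltW bq).
      by exists b => // s bs sq; split; [apply: aB => //; exact: le_trans bs|exact: bC].
    by exists a => // s as_ sq; split; [exact: aB|apply: bC => //; exact: le_trans as_].
  - by move=> B C BC [a aq aB]; exists a => // s as_ sq; apply/BC/aB.
suff Fq : F --> q.
  by move=> /Fq[a aq aA]; exists a => //; exact: aA.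
apply: wedge_filter_cvg => _ [g Gg [->|->]] /= gq.
  exists g => //; rewrite lt_neqAle gq andbT; apply/eqP => gE; subst g.
  case: Gg => // /(_ r (ltW rq)) qr.
  by have := le_lt_trans qr rq; rewrite ltxx.
by exists r => // s _ sq /= gs; apply: gq; exact: le_trans (ltW sq).
Qed.

End wedge_topology.

(** * Norming sets of functionals *)

Section supremum.
Context {R : realType} {K : numFieldType}.
Variable sK : scalar_field R K.

Lemma supremum_le (A : set K) (M : K) : 0 <= M -> ubound A M -> supremum 0 A <= M.
Proof.
move=> M0 AM; rewrite /supremum; case: ifPn => // _.
by case: xgetP => [z _ [_]|//]; apply.
Qed.

(** Both fields of scalars have suprema only for nonempty bounded sets of
    nonnegative elements, whence the hypotheses. *)
Lemma supremum_ge (A : set K) (M a : K) : (forall x, A x -> 0 <= x) ->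
  ubound A M -> A a -> a <= supremum 0 A.
Proof.
move=> A0 AM Aa; rewrite /supremum ifF; last first.
  by apply/negbTE/set0P; exists a.
have [||z zA] := scalar_supremums sK _ A0; [by exists a|by exists M|].
by case: xgetP => [x _ [+ _]|/(_ z)//]; apply.
Qed.

End supremum.

Section dual_theory.
Context {R : realType} {K : numFieldType}.
Variables (sK : scalar_field R K) (X : completeNormedModType K).

Lemma contractive_dual (phi : X -> K) : scalar phi -> (forall x, `|phi x| <= `|x|) ->
  exists2 f : dual X, forall x, f x = phi x & dual_ball f.
Proof.
move=> phiS phi1.
pose L : {scalar X} := HB.pack phi (GRing.isLinear.Build K X K *%R phi phiS).
have cL : continuous (L : X -> K).
  move=> x; apply/cvgrPdist_le => e e0.
  have /cvgrPdist_le/(_ e e0) : x @[x --> x] --> x by exact: cvg_id.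
  apply: filterS => y; apply: le_trans.
  by rewrite -[L x - L y](raddfB L x y); exact: phi1.
exists (Dual cL) => //; apply: supremum_le => // _ [x /= x1 <-].
exact: le_trans (phi1 x) x1.
Qed.

(** Needed to know that [dual_norm] is a genuine supremum rather than the default
    value of [supremum] on unbounded sets. *)
Lemma dual_bounded (f : dual X) : exists M : K, forall x, `|x| <= 1 -> `|f x| <= M.
Proof.
have /cvgrPdist_lt/(_ 1 ltr01) := @dual_continuous _ _ f 0.
rewrite linear0 => /nbhs_ballP[e /= e0 eb]; exists (2 / e) => x x1.
have e20 : 0 < e / 2 by rewrite divr_gt0.
have /eb/= : ball 0 e ((e / 2) *: x).
  rewrite -ball_normE /ball_/= sub0r normrN normrZ gtr0_norm//.
  rewrite (le_lt_trans (ler_piMr (ltW e20) x1))//.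
  by rewrite ltr_pdivrMr// ltr_pMr// ltr1n.
rewrite linearZ/= sub0r normrN normrM gtr0_norm// mulrC -ltr_pdivlMr//.
by rewrite div1r invf_div => /ltW.
Qed.

Lemma dual_ball_le (f : dual X) : dual_ball f -> forall x, `|f x| <= `|x|.
Proof.
move=> f1 x; have [->|x0] := eqVneq x 0; first by rewrite linear0 !normr0.
have nx0 : 0 < `|x| by rewrite normr_gt0.
have [M fM] := dual_bounded f.
suff : `|f (`|x|^-1 *: x)| <= 1.
  by rewrite linearZ/= normrM normfV normr_id ler_pdivrMl// mulr1.
apply: le_trans f1; apply: (supremum_ge sK (M := M)).
- by move=> _ [y _ <-].
- by move=> _ [y y1 <-]; exact: fM.
- exists (`|x|^-1 *: x) => //=.
  by rewrite normrZ normfV normr_id mulVf// gt_eqF.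
Qed.

Lemma norming_sup_ge (D : set (dual X)) (f : dual X) (x : X) : D f -> dual_ball f ->
  `|f x| <= supremum 0 [set `|g x| | g in D `&` @dual_ball K X].
Proof.
move=> Df f1; apply: (supremum_ge sK (M := `|x|)).
- by move=> _ [g _ <-].
- by move=> _ [g [_ g1] <-]; exact: dual_ball_le.
- by exists f.
Qed.

Lemma linear_span0 (M : set X) : linear_span M 0.
Proof.
by exists 0%N, (fun=> 0), (fun=> 0); split; [case|rewrite big_ord0].
Qed.

Lemma linear_span_gen (M : set X) m : M m -> linear_span M m.
Proof.
by move=> Mm; exists 1%N, (fun=> 1), (fun=> m); split => //; rewrite big_ord1 scale1r.
Qed.

Lemma linear_spanZ (M : set X) k x : linear_span M x -> linear_span M (k *: x).
Proof.
move=> [n [c [m [Mm ->]]]]; exists n, (fun i => k * c i), m; split => //.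
by rewrite scaler_sumr; apply: eq_bigr => i _; rewrite scalerA.
Qed.

Lemma linear_spanD (M : set X) x y :
  linear_span M x -> linear_span M y -> linear_span M (x + y).
Proof.
move=> [n1 [c1 [m1 [Mm1 ->]]]] [n2 [c2 [m2 [Mm2 ->]]]].
pose glue U (u : 'I_n1 -> U) (v : 'I_n2 -> U) (i : 'I_(n1 + n2)) :=
  match fintype.split i with inl j => u j | inr j => v j end.
exists (n1 + n2)%N, (glue _ c1 c2), (glue _ m1 m2); split.
  by move=> i; rewrite /glue; case: fintype.split.
rewrite big_split_ord/=; congr (_ + _); apply: eq_bigr => i _.
  by rewrite /glue (unsplitK (inl i)).
by rewrite /glue (unsplitK (inr i)).
Qed.

Lemma linear_span_ind (M : set X) (P : X -> Prop) : P 0 ->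
  (forall k m x, M m -> P x -> P (k *: m + x)) ->
  forall x, linear_span M x -> P x.
Proof.
move=> P0 PD _ [n [c [m [Mm ->]]]].
by apply: (big_rec P) => // i x _; exact: PD.
Qed.

End dual_theory.

(** * Indicators of wedges *)

Section wedge_indicators.
Context {R : realType} {K : numFieldType} (sK : scalar_field R K).
Context {d : Order.disp_t} {T : porderType d}.
Hypotheses (treeT : is_tree T) (rootT : rooted T) (ccT : chain_complete T).

Local Notation CT := (cont_space sK (coarse_wedge_compact treeT rootT ccT)).
Local Notation open_wedge s := (wochoice.minimal <=%O s \/ successor_level s).

Definition wedge_indicators : set CT :=
  [set m | exists2 s : T, open_wedge s & val m = \1_(wedge s) :> (T -> K)].

(** The span of the indicators, as plain functions so that they can be
    multiplied. *)
Definition wedge_algebra : set (T -> K) :=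
  [set g | exists2 m : CT, linear_span wedge_indicators m & val m = g].

Lemma wedge_indicator_continuous (s : T) : open_wedge s ->
  continuous (\1_(wedge s) : coarse_wedge T -> K).
Proof.
move=> rs x; have [xs|xNs] := pselect (wedge s x).
  have Vs : nbhs (x : coarse_wedge T) (wedge s).
    by apply: open_nbhs_nbhs; split => //; apply: wedge_subbase_open; exists s; [|left].
  apply: (@cvg_near_cst _ _ _ _ (nbhs (x : coarse_wedge T))).
  apply: filterS Vs => y sy.
  by rewrite !indicE !mem_set.
have Vs : nbhs (x : coarse_wedge T) (~` wedge s).
  by apply: open_nbhs_nbhs; split => //; apply: wedge_subbase_open; exists s; [|right].
apply: (@cvg_near_cst _ _ _ _ (nbhs (x : coarse_wedge T))).
  apply: filterS Vs => y sy.
by rewrite !indicE !memNset.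
Qed.

Lemma wedge_algebra_gen (s : T) : open_wedge s -> wedge_algebra \1_(wedge s).
Proof.
move=> rs; pose l : coarse_wedge T -> K^o := \1_(wedge s).
have cl : l \in @continuous_pred (coarse_wedge T) K.
  by apply/mem_set; exact: wedge_indicator_continuous.
by exists (exist _ l cl : CT) => //; apply: linear_span_gen; exists s.
Qed.

Lemma wedge_algebra0 : wedge_algebra (fun=> 0).
Proof. by exists 0 => //; exact: linear_span0. Qed.

Lemma wedge_algebraD g1 g2 : wedge_algebra g1 -> wedge_algebra g2 ->
  wedge_algebra (g1 \+ g2).
Proof.
by move=> [m1 s1 <-] [m2 s2 <-]; exists (m1 + m2) => //; exact: linear_spanD.
Qed.

Lemma wedge_algebraZ k g : wedge_algebra g -> wedge_algebra (fun x => k * g x).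
Proof. by move=> [m sm <-]; exists (k *: m) => //; exact: linear_spanZ. Qed.

Lemma wedge_algebra_ind (P : (T -> K) -> Prop) : P (fun=> 0) ->
  (forall k s g, open_wedge s -> P g -> P (fun x => k * \1_(wedge s) x + g x)) ->
  forall g, wedge_algebra g -> P g.
Proof.
move=> P0 PD g [m sm <-]; move: m sm.
apply: linear_span_ind => [//|k m x [s rs ms] Px].
by have := PD k s _ rs Px; rewrite -ms.
Qed.

(** Two wedges are nested or disjoint, so products of generators are generators
    or zero. *)
Lemma wedge_algebraM g1 g2 : wedge_algebra g1 -> wedge_algebra g2 ->
  wedge_algebra (g1 \* g2).
Proof.
move=> A1 A2; move: g1 A1; apply: wedge_algebra_ind => [|k s g rs Ag].
  rewrite [X in wedge_algebra X](_ : _ = fun=> 0); first exact: wedge_algebra0.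
  by apply/funext => x /=; rewrite mul0r.
rewrite [X in wedge_algebra X](_ : _ =
    (fun x => k * (\1_(wedge s) x * g2 x)) \+ (g \* g2)); last first.
  by apply/funext => x /=; rewrite mulrDl mulrA.
apply: wedge_algebraD Ag; apply: wedge_algebraZ.
move: g2 A2; apply: wedge_algebra_ind => [|l u f ru Af].
  rewrite [X in wedge_algebra X](_ : _ = fun=> 0); first exact: wedge_algebra0.
  by apply/funext => x /=; rewrite mulr0.
rewrite [X in wedge_algebra X](_ : _ =
    (fun x => l * \1_(wedge s `&` wedge u) x) \+ (fun x => \1_(wedge s) x * f x)).
  apply: wedge_algebraD Af; apply: wedge_algebraZ.
  have [su|nsu] := pselect (s <= u)%O.
    rewrite setIidr; first exact: wedge_algebra_gen.
    by move=> x; exact: le_trans.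
  have [us|nus] := pselect (u <= s)%O.
    rewrite setIidl; first exact: wedge_algebra_gen.
    by move=> x; exact: le_trans.
  rewrite (_ : _ `&` _ = set0) ?indic0; first exact: wedge_algebra0.
  rewrite -subset0 => x [/= sx ux].
  by have /orP[] := tree_down_total treeT sx ux.
by apply/funext => x /=; rewrite indicI/=; ring.
Qed.

Lemma wedge_algebra1 : wedge_algebra \1_[set: T].
Proof.
have [r minr rle] := tree_root treeT rootT.
rewrite (_ : setT = wedge r); first by apply: wedge_algebra_gen; left.
by apply/seteqP; split => x // _; exact: rle.
Qed.

Lemma wedge_algebraC (E : set T) : wedge_algebra \1_E -> wedge_algebra \1_(~` E).
Proof.
move=> AE; rewrite (_ : \1__ = \1_[set: T] \+ (fun x => -1 * \1_E x)).
  by apply: wedge_algebraD; [exact: wedge_algebra1|exact: wedge_algebraZ].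
apply/funext => x /=; rewrite indicC indicT/= indicE.
by case: (x \in E); rewrite /= ?mulr1 ?mulr0 ?addr0 ?subrr.
Qed.

Lemma wedge_algebraI (E F : set T) :
  wedge_algebra \1_E -> wedge_algebra \1_F -> wedge_algebra \1_(E `&` F).
Proof. by move=> AE AF; rewrite indicI; exact: wedge_algebraM. Qed.

Section approximation.
Variables (f : CT) (e : K).
Hypothesis e0 : 0 < e.

(** Asking for [\1_E] in the algebra allows to glue approximations on two sets
    along [\1_E], so that compactness reduces approximability to a local
    property. *)
Definition approximable (E : set T) := wedge_algebra \1_E /\
  exists2 g, wedge_algebra g & forall x, E x -> `|val f x - g x| <= e.

Lemma approximable_local (t : T) :
  exists2 E, nbhs (t : coarse_wedge T) E & approximable E.
Proof.
pose G : set_system (coarse_wedge T) := [set B | exists2 E, E `<=` B &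
  nbhs (t : coarse_wedge T) E /\ wedge_algebra \1_E].
have FG : Filter G.
  split.
  - by exists setT => //; split; [exact: filterT|exact: wedge_algebra1].
  - move=> B C [E EB [tE AE]] [F FC [tF AF]]; exists (E `&` F); first exact: setISS.
    by split; [exact: filterI|exact: wedge_algebraI].
  - by move=> B C BC [E EB AE]; exists E => //; exact: subset_trans BC.
have Gt : G --> (t : coarse_wedge T).
  apply: wedge_filter_cvg => A sA At; exists A => //; split.
    by apply: open_nbhs_nbhs; split => //; exact: wedge_subbase_open.
  by case: sA => s rs [->|->]; last apply: wedge_algebraC; exact: wedge_algebra_gen.
have [E Ef [tE AE]] : G [set x | `|val f t - val f x| <= e].
  apply: Gt; have := @cont_space_continuous _ _ _ sK _ f t.
  by move=> /cvgrPdist_le/(_ _ e0).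
exists E => //; split => //; exists (fun x => val f t * \1_[set: T] x).
  by apply: wedge_algebraZ; exact: wedge_algebra1.
by move=> x /Ef; rewrite indicT mulr1 distrC.
Qed.

Lemma approximableU (E F : set T) : approximable E -> approximable F ->
  approximable (E `|` F).
Proof.
move=> [AE [g1 A1 fg1]] [AF [g2 A2 fg2]]; split.
  rewrite -(setCK (E `|` F)) setCU; apply: wedge_algebraC.
  by apply: wedge_algebraI; exact: wedge_algebraC.
exists ((\1_E \* g1) \+ (\1_(~` E) \* g2)).
  by apply: wedge_algebraD; apply: wedge_algebraM => //; exact: wedge_algebraC.
move=> x EFx /=; rewrite indicC indicE.
have [Ex|nEx] := pselect (E x).
  by rewrite mem_set//= mul1r mul0r addr0; exact: fg1.
by rewrite memNset//= mul0r mul1r add0r; apply: fg2; case: EFx.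
Qed.

Lemma approximable0 : approximable set0.
Proof.
split; first by rewrite indic0; exact: wedge_algebra0.
by exists (fun=> 0) => //; exact: wedge_algebra0.
Qed.

(** Otherwise the complements of the approximable sets would generate a proper
    filter, and no point could be a cluster point of it. *)
Lemma approximableT : approximable setT.
Proof.
apply: contrapT => nT.
pose F : set_system (coarse_wedge T) := [set B | exists2 E, approximable E & ~` E `<=` B].
have FF : ProperFilter F.
  split.
    by case=> E aE; rewrite subset0 -setCT => /setC_inj ET; apply: nT; rewrite -ET.
  split.
  - by exists set0 => //; exact: approximable0.
  - move=> B C [E aE EB] [D aD DC]; exists (E `|` D); first exact: approximableU.
    by rewrite setCU; exact: setISS.
  - by move=> B C BC [E aE EB]; exists E => //; exact: subset_trans BC.
have [t [_ Ft]] := coarse_wedge_compact treeT rootT ccT FF (@filterT _ _ FF).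
have [E tE aE] := approximable_local t.
have [|x [nEx /nEx//]] := Ft (~` E) E _ tE.
by exists E.
Qed.

End approximation.

Lemma wedge_indicators_dense : closure (linear_span wedge_indicators) = [set: CT].
Proof.
apply/seteqP; split => // f _ B /nbhs_ballP[e /= e0 eB].
have e20 : 0 < e / 2 by rewrite divr_gt0.
have [_ [_ [m sm <-] fm]] := approximableT f e20.
exists m; split => //; apply: eB; rewrite -ball_normE /ball_/=.
apply: (@le_lt_trans _ _ (e / 2)); last by rewrite ltr_pdivrMr// ltr_pMr// ltr1n.
by apply: sup_norm_le (ltW e20) _ => x; exact: fm.
Qed.

(** * Countably supported functionals *)

Definition wedge_Sigma : set (dual CT) :=
  [set f | countable [set m | wedge_indicators m /\ f m <> 0]].

Lemma countable_wedge_indicators (A : set T) (P : set CT) : countable A ->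
  (forall m, P m -> exists2 s, A s & val m = \1_(wedge s) :> (T -> K)) ->
  countable P.
Proof.
move=> /countable_injP[F FI] PA.
have ex m : exists s, P m -> A s /\ val m = \1_(wedge s) :> (T -> K).
  have [Pm|nPm] := pselect (P m); last by have [r _] := rootT; exists r.
  by have [s] := PA m Pm; exists s.
have [g gP] := choice ex; apply/countable_injP; exists (F \o g).
move=> m1 m2 /set_mem P1 /set_mem P2 /= /FI gE; apply: val_inj.
have [A1 ->] := gP _ P1; have [A2 ->] := gP _ P2.
by rewrite gE//; exact/mem_set.
Qed.

(** An indicator that does not vanish at [t] is that of a wedge whose root is below
    [t], and there are only countably many such roots. *)
Lemma point_functional (t r : T) : wochoice.minimal <=%O r -> countably_close r t ->
  exists f : dual CT, [/\ wedge_Sigma f, dual_ball f & forall x : CT, f x = val x t].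
Proof.
move=> minr crt; have [||f fE f1] := @contractive_dual K CT (fun x => val x t).
- by move=> k x y.
- by move=> x; exact: sup_norm_ge.
exists f; split => //; apply: (countable_wedge_indicators crt).
move=> m [[s rs ms]]; rewrite fE ms indicE => st; exists s => //; split.
  have [r0 minr0 r0le] := tree_root treeT rootT.
  exact: le_trans (minr _ (r0le r)) (r0le s).
by apply: contrapT => nst; apply: st; rewrite memNset.
Qed.

(** The indicator of a wedge takes the same value at [q] and [t] unless its root is
    between them; the factor [2^-1] makes the norm at most one. *)
Lemma difference_functional (q t : T) : (q <= t)%O -> countably_close q t ->
  exists f : dual CT, [/\ wedge_Sigma f, dual_ball f &
    forall x : CT, f x = 2^-1 * (val x t - val x q)].
Proof.
move=> qt cqt.
have [||f fE f1] := @contractive_dual K CT (fun x => 2^-1 * (val x t - val x q)).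
- move=> k x y.
  have E u : val (k *: x + y) u = k * val x u + val y u by [].
  by rewrite !E; ring.
- move=> x; rewrite normrM gtr0_norm ?invr_gt0// ler_pdivrMl// mulr_natl mulr2n.
  by rewrite (le_trans (ler_normB _ _))// lerD// sup_norm_ge.
exists f; split => //; apply: (countable_wedge_indicators cqt).
move=> m [[s rs ms]]; rewrite fE ms !indicE => st; exists s => //.
have tV : (s <= t)%O.
  apply: contrapT => nst; apply: st; rewrite !memNset ?subrr ?mulr0// => sq.
  by apply: nst; exact: le_trans qt.
split => //; have /orP[//|sq] := tree_down_total treeT qt tV.
by case: st; rewrite !mem_set ?subrr ?mulr0.
Qed.

(** Induction on the index of the block. Passing from the bottom [q] of a block to
    one of its nodes [t] costs [2 C], because [(delta_t - delta_q) / 2] is among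
    the functionals; passing to [q] from the lower blocks costs nothing, because
    [q] is a limit of their nodes. *)
Lemma block_norm_bound (b : T -> nat) (x : CT) (C : K) :
  (forall s t, (s <= t)%O -> (b s <= b t)%N) ->
  (forall s t, b s = b t -> countably_close s t) ->
  (forall f : dual CT, wedge_Sigma f -> dual_ball f -> `|f x| <= C) ->
  forall k t, (b t <= k)%N -> `|val x t| <= k.*2.+1%:R * C.
Proof.
move=> bmono bclose fC.
have C0 : 0 <= C.
  have [r minr _] := tree_root treeT rootT.
  have [f [Sf f1 _]] := point_functional minr (countably_close_refl r).
  exact: le_trans (fC f Sf f1).
elim=> [|k IH] t btk.
  have [r minr rle] := tree_root treeT rootT.
  have [|f [Sf f1 fE]] := @point_functional t r minr.
    apply: bclose; apply/eqP; rewrite eqn_leq bmono//=.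
    exact: leq_trans btk _.
  by rewrite mul1r -fE; exact: fC.
have [q [qt cqt qmin]] := block_bottom treeT t.
have [[r rq]|nrq] := pselect (exists r, (r < q)%O); last first.
  have minq : wochoice.minimal <=%O q.
    move=> s sq; have [->//|sNq] := eqVneq s q.
    by case: nrq; exists s; rewrite lt_neqAle sNq.
  have [f [Sf f1 fE]] := point_functional minq cqt.
  rewrite -fE (le_trans (fC f Sf f1))// -[leLHS]mul1r ler_wpM2r//.
  by rewrite ler1n.
(* a node below [q] with the same index would be close to [q], hence to [t] *)
have lower s : (s < q)%O -> (b s <= k)%N.
  move=> sq; rewrite -ltnS (leq_trans _ btk)// (leq_trans _ (bmono _ _ qt))//.
  rewrite ltn_neqAle bmono ?(ltW sq)// andbT; apply/eqP => /bclose csq.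
  have /(lt_le_trans sq) : (q <= s)%O; last by rewrite ltxx.
  apply: qmin; first exact: le_trans (ltW sq) qt.
  exact: (countably_close_trans treeT qt csq cqt).
have xq : `|val x q| <= k.*2.+1%:R * C.
  apply/ler_addgt0Pr => e e0.
  have := @cont_space_continuous _ _ _ sK _ x q.
  move=> /cvgrPdist_le/(_ _ e0)/(limit_node_cvg treeT).
  move=> /(_ (ex_intro _ r rq) (block_bottom_limit treeT qt cqt qmin))[s sq xqs].
  rewrite -(subrK (val x s) (val x q)) (le_trans (ler_normD _ _))// addrC lerD//.
  by apply: IH; exact: lower.
have [f [Sf f1 fE]] := difference_functional qt cqt.
have := fC f Sf f1; rewrite fE normrM gtr0_norm ?invr_gt0// ler_pdivrMl// => xtq.
rewrite -(subrK (val x q) (val x t)) (le_trans (ler_normD _ _))//.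
rewrite (le_trans (lerD xtq xq))// -mulrDl -natrD.
by rewrite doubleS.
Qed.

End wedge_indicators.

Theorem theorem4p3 (R : realType) (K : numFieldType) (sK : scalar_field R K)
    (d : Order.disp_t) (T : porderType d)
    (treeT : is_tree T) (rootT : rooted T) (ccT : chain_complete T)
    (h : wellOrder) (hT : tree_height T h)
    (h_lt : ord_lt h (ord_mul omega1 omega0)) :
  Plichko (cont_space sK (coarse_wedge_compact treeT rootT ccT)).
Proof.
have [n [b [bn bmono bclose]]] := tree_blocks treeT hT.1 h_lt.
exists (@wedge_Sigma _ _ sK _ _ treeT rootT ccT).
  by exists (@wedge_indicators _ _ sK _ _ treeT rootT ccT) => //; exact: wedge_indicators_dense.
exists n.*2.+1%:R; first by rewrite ler1n.
move=> x; set C := supremum _ _.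
have fC (f : dual (cont_space sK (coarse_wedge_compact treeT rootT ccT))) :
    wedge_Sigma f -> dual_ball f -> `|f x| <= C.
  by move=> Sf f1; exact: (norming_sup_ge sK).
have bound := block_norm_bound bmono bclose fC.
have [r _ _] := tree_root treeT rootT.
apply: sup_norm_le => [|t]; last exact: bound.
exact: le_trans (normr_ge0 _) (bound n r (bn r)).
Qed.
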